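(* Let $1<p<\infty$, let $a,b,d\in\mathbb{C}$, and let $T\in\mathbb{L}(\ell^2_p)$ be the operator given by the matrix $T=\begin{pmatrix}a & b\\ 0 & d\end{pmatrix}$. Then the numerical range $V(T)$ is a convex set.
   Context: $\ell^2_p$ denotes the complex vector space $\mathbb{C}^2$ with norm $\|x\|_p=(|x_1|^p+|x_2|^p)^{1/p}$, and $\mathbb{L}(\ell^2_p)$ is the space of (bounded) linear operators on it; operators are identified with $2\times 2$ complex matrices acting on column vectors in the standard basis. The unique semi-inner-product compatible with the norm is $[x,y]_p=\dfrac{\sum_{k} x_k\overline{y_k}|y_k|^{p-2}}{\|y\|_p^{p-2}}$ for $y\neq 0$ and $[x,0]_p=0$ (where $\overline{y_k}|y_k|^{p-2}$ is read as $0$ when $y_k=0$). The numerical range is $V(T)=\{[Tx,x]_p : \|x\|_p=1\}\subset\mathbb{C}$. *)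

(* Defs.v *)
From HB Require Import structures.
From mathcomp Require Export all_boot all_order all_algebra.
From mathcomp Require Export complex.
From mathcomp Require Export boolp classical_sets reals exp convex.

Set Implicit Arguments.
Unset Strict Implicit.
Unset Printing Implicit Defensive.

Import Order.TTheory GRing.Theory Num.Theory.

Local Open Scope classical_set_scope.
Local Open Scope ring_scope.

Section lp_numerical_range.
Context {R : realType} {n : nat}.
Local Notation normc := (@ComplexField.Normc.normc R).
Implicit Types (p : R) (x y : 'cV[R[i]]_n).

Definition lpnorm p x : R :=
  (\sum_(k < n) normc (x k ord0) `^ p) `^ p^-1.

(* A summand with y_k = 0 vanishes whatever the value of 0 `^ (p - 2), since
   the factor conj(y_k) is 0. *)
Definition semi_inner p x y : R[i] :=
  if y == 0 then 0
  else (\sum_(k < n) x k ord0 * conjc (y k ord0) *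
          real_complex R (normc (y k ord0) `^ (p - 2)))
       / real_complex R (lpnorm p y `^ (p - 2)).

(* Every linear operator on C^n is bounded, so boundedness is not recorded. *)
Definition numerical_range p (T : {linear 'cV[R[i]]_n -> 'cV[R[i]]_n}) :
    set R[i] :=
  [set semi_inner p (T x) x | x in [set x | lpnorm p x = 1]].

End lp_numerical_range.

(* Main.v *)
(* With u = |x_1|^p, the vectors x of norm 1 with a given u yield the circle of
   center u a + (1 - u) d and radius |b| u^(1 - 1/p) (1 - u)^(1/p), as the phase
   of x_2 / x_1 varies.  The radius is a concave function of u vanishing at
   u = 0, so the corresponding discs have a convex union, and by the
   intermediate value theorem a point of one of the discs lies on one of the
   circles: the union of the circles is the union of the discs. *)
Require Import Defs.
From mathcomp Require Import ring lra.
From mathcomp Require Import unstable interval_inference topology normedtype.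
From mathcomp Require Import derive realfun hoelder.
Import Order.TTheory GRing.Theory Num.Theory ComplexField.Normc.
Import numFieldNormedType.Exports.
Local Open Scope classical_set_scope.
Local Open Scope ring_scope.

(* Without the absolute value continuity fails at 0: x `^ a is 1 for x < 0. *)
Lemma continuous_norm_powR (R : realType) (a : R) : 0 < a ->
  continuous (fun x : R => `|x| `^ a).
Proof.
move=> a0 x; have [->|x0] := eqVneq x 0.
  apply/cvgrPdist_lt => e e0; rewrite normr0 powR0 ?gt_eqF//.
  near=> y; rewrite sub0r normrN ger0_norm ?powR_ge0//.
  (* Monotonicity of [_]^ a[then reduces the goal to]|y| < e [^ a^-1]. *)
  have -> : e = (e `^ a^-1) `^ a by rewrite -powRrM mulVf ?gt_eqF// powRr1 ?ltW.
  apply: gt0_ltr_powR => //; rewrite ?nnegrE ?powR_ge0 ?normr_ge0//.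
  by near: y; apply: (@nbhs0_lt _ R^o); exact: powR_gt0.
apply: (@continuous_comp _ _ _ (fun y : R => `|y|) (@powR R ^~ a)).
  exact: norm_continuous.
apply/differentiable_continuous; rewrite -derivable1_diffP.
by apply: derivable_powR; rewrite in_itv/= andbT normr_gt0.
Unshelve. all: by end_near. Qed.

Lemma normc_conjc (R : rcfType) (z : R[i]) : normc (conjc z) = normc z.
Proof. by case: z => a b /=; rewrite sqrrN. Qed.

Lemma normc_ge0 (R : rcfType) (z : R[i]) : 0 <= normc z.
Proof. by case: z => a b; exact: sqrtr_ge0. Qed.

Lemma normc_real (R : rcfType) (x : R) : normc (real_complex R x) = `|x|.
Proof. by rewrite /= expr0n addr0 sqrtr_sqr. Qed.

Lemma mulc_conjc (R : rcfType) (z : R[i]) :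
  z * conjc z = real_complex R (normc z ^+ 2).
Proof.
case: z => a b /=; rewrite sqr_sqrtr ?addr_ge0 ?sqr_ge0//.
apply/eqP; rewrite eq_complex /=; apply/andP; split; apply/eqP; ring.
Qed.

Lemma continuous_normc_affine (R : realType) (z w : R[i]) :
  continuous (fun u : R => normc (z + real_complex R u * w)).
Proof.
case: z w => x y [x' y'] u /=.
apply: (@continuous_comp _ _ _ (fun u : R => _) (@Num.sqrt R));
  last exact: sqrt_continuous.
have cst (k : R) : {for u, continuous (fun _ : R => k)}.
  exact: cvg_cst.
have sqr (f : R -> R) :
    {for u, continuous f} -> {for u, continuous (fun v => f v ^+ 2)}.
  by move=> ?; exact: continuousM.
have aff (k x1 x2 : R) : {for u, continuous (fun v : R => k + (v * x1 + x2))}.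
  apply: (continuousD (cst k)); apply: (continuousD _ (cst x2)).
  by apply: (continuousM _ (cst x1)); exact: cvg_id.
exact: continuousD (sqr _ (aff _ _ _)) (sqr _ (aff _ _ _)).
Qed.

(** The phase is [z / w], or [1] when both numbers vanish. It turns a point of a circle into the
    phase of a coordinate. *)
Lemma eq_normc_phase (R : rcfType) (z w : R[i]) : normc z = normc w ->
  exists2 e, normc e = 1 & z = w * e.
Proof.
have [->|w0] := eqVneq w 0.
  by rewrite normc0 => /eq0_normc ->; exists 1; rewrite ?normc1 ?mul0r.
move=> zw; exists (z / w); last by rewrite mulrCA divff ?mulr1.
rewrite normcM normcV zw divff//.
by apply: contra w0 => /eqP/eq0_normc ->.
Qed.

(* Hoelder's inequality with exponents 1/s and 1/t. *)
Lemma geo_mean_superadd (R : realType) (s t x1 x2 y1 y2 : R) :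
  0 < s -> 0 < t -> s + t = 1 ->
  0 <= x1 -> 0 <= x2 -> 0 <= y1 -> 0 <= y2 ->
  x1 `^ s * y1 `^ t + x2 `^ s * y2 `^ t <=
  (x1 + x2) `^ s * (y1 + y2) `^ t.
Proof.
move=> s0 t0 st x10 x20 y10 y20.
have := @hoelder2 R (x1 `^ s) (x2 `^ s) (y1 `^ t) (y2 `^ t) s^-1 t^-1.
rewrite !powR_ge0 !invr_gt0 !invrK -!powRrM !divff ?gt_eqF// !powRr1//.
exact.
Qed.

(** As [s + t = 1], the weighted geometric mean is homogeneous of degree 1: the weights [l] and
    [1 - l] move inside, and superadditivity becomes concavity. *)
Lemma geo_mean_conv (R : realType) (s t l x1 x2 y1 y2 : R) :
  0 < s -> 0 < t -> s + t = 1 -> 0 <= l <= 1 ->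
  0 <= x1 -> 0 <= x2 -> 0 <= y1 -> 0 <= y2 ->
  l * (x1 `^ s * y1 `^ t) + (1 - l) * (x2 `^ s * y2 `^ t) <=
  (l * x1 + (1 - l) * x2) `^ s * (l * y1 + (1 - l) * y2) `^ t.
Proof.
move=> s0 t0 st /andP[l0 l1] x10 x20 y10 y20.
have m0 : 0 <= 1 - l by rewrite subr_ge0.
have H k x y : 0 <= k -> 0 <= x -> 0 <= y ->
    k * (x `^ s * y `^ t) = (k * x) `^ s * (k * y) `^ t.
  move=> k0 x0 y0; rewrite !powRM// mulrACA -powRD st ?oner_eq0//.
  by rewrite powRr1.
by rewrite !H//; apply: geo_mean_superadd => //; rewrite mulr_ge0.
Qed.

Section upper_triangular.
Variables (R : realType) (p : R).
Hypothesis p_gt1 : 1 < p.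
Implicit Types (a b d z : R[i]) (u : R).
Local Notation C := (real_complex R).

Let p_gt0 : 0 < p. Proof. exact: lt_trans p_gt1. Qed.
Let p_neq0 : p != 0. Proof. by rewrite gt_eqF. Qed.
Let pV_gt0 : 0 < p^-1. Proof. by rewrite invr_gt0. Qed.
Let cpV_gt0 : 0 < 1 - p^-1. Proof. by rewrite subr_gt0 invf_lt1. Qed.

Definition radius u : R := u `^ (1 - p^-1) * (1 - u) `^ p^-1.

Definition center a d u : R[i] := d + C u * (a - d).

Lemma lpnorm2_eq1 (x : 'cV[R[i]]_2) :
  lpnorm p x = 1 <-> normc (x 0 0) `^ p + normc (x 1 0) `^ p = 1.
Proof.
rewrite /lpnorm big_ord_recl big_ord1.
have -> : lift ord0 ord0 = 1 :> 'I_2 by apply/val_inj.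
set S := _ + _; have S0 : 0 <= S by rewrite addr_ge0 ?powR_ge0.
split=> [S1|->]; last by rewrite powR1.
by rewrite -(powRr1 S0) -[X in S `^ X](mulVf p_neq0) powRrM S1 powR1.
Qed.

Lemma block_mx2_mulE a b d (x : 'cV[R[i]]_2) :
  let y := (block_mx a%:M b%:M 0 d%:M : 'M[R[i]]_(1 + 1)) *m x in
  y 0 0 = a * x 0 0 + b * x 1 0 /\ y 1 0 = d * x 1 0.
Proof.
have E0 : 0 = lshift 1 0 :> 'I_(1 + 1) by apply/val_inj.
have E1 : 1 = rshift 1 0 :> 'I_(1 + 1) by apply/val_inj.
move=> y; rewrite /y !mxE !big_ord_recl !big_ord0.
have -> : lift ord0 ord0 = 1 :> 'I_2 by apply/val_inj.
rewrite -[ord0]/(0 : 'I_2) E0 E1 !addr0.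
rewrite block_mxEul block_mxEur block_mxEdl block_mxEdr !mxE/=.
by rewrite !mulr1n mul0r add0r.
Qed.

Lemma mul_conjc_powR z :
  z * conjc z * C (normc z `^ (p - 2)) = C (normc z `^ p).
Proof.
rewrite mulc_conjc -rmorphM; congr (C _).
have [->|z0] := eqVneq (normc z) 0; first by rewrite expr0n mul0r powR0.
by rewrite -powR_mulrn ?normc_ge0// -powRD ?z0 ?implybT// addrC subrK.
Qed.

Lemma mul_powRB2 u : 0 <= u -> u * u `^ (p - 2) = u `^ (p - 1).
Proof.
move=> u0; rewrite -(@mulr_powRB1 _ u (p - 1))// ?subr_gt0//.
by congr (_ * _ `^ _); ring.
Qed.

(** The diagonal terms depend only on the moduli of the coordinates and, since [x] has norm 1, add
    up to the center; the off-diagonal term alone carries the phases. *)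
Lemma semi_inner_upper a b d (T : {linear 'cV[R[i]]_2 -> 'cV[R[i]]_2})
    (x : 'cV[R[i]]_2) :
  (forall x : 'cV[R[i]]_2,
     T x = (block_mx a%:M b%:M 0 d%:M : 'M[R[i]]_(1 + 1)) *m x) ->
  lpnorm p x = 1 ->
  semi_inner p (T x) x = center a d (normc (x 0 0) `^ p) +
    b * x 1 0 * (conjc (x 0 0) * C (normc (x 0 0) `^ (p - 2))).
Proof.
move=> hT x1; rewrite /semi_inner ifF; last first.
  apply/negP => /eqP x0; move: x1 => /lpnorm2_eq1.
  by rewrite x0 !mxE normc0 powR0// addr0 => /eqP; rewrite eq_sym oner_eq0.
rewrite x1 powR1 divr1 big_ord_recl big_ord1.
have -> : lift ord0 ord0 = 1 :> 'I_2 by apply/val_inj.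
rewrite -[ord0]/(0 : 'I_2) -[ord0]/(0 : 'I_1).
rewrite hT; have [/= -> ->] := block_mx2_mulE a b d x.
(* The norm condition takes the shape of the summands of the semi-inner product, so that putting it
   for the 1 in [d * 1] leaves a ring identity. *)
have e1 : 1 = x 0 0 * conjc (x 0 0) * C (normc (x 0 0) `^ (p - 2)) +
               x 1 0 * conjc (x 1 0) * C (normc (x 1 0) `^ (p - 2)).
  by rewrite !mul_conjc_powR -rmorphD (lpnorm2_eq1 x).1// rmorph1.
rewrite /center -mul_conjc_powR -[X in X + _ * (a - d)]mulr1 e1; ring.
Qed.

Lemma numerical_range_upper a b d
    (T : {linear 'cV[R[i]]_2 -> 'cV[R[i]]_2}) z :
  (forall x : 'cV[R[i]]_2,
     T x = (block_mx a%:M b%:M 0 d%:M : 'M[R[i]]_(1 + 1)) *m x) ->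
  numerical_range p T z <->
  exists2 u, 0 <= u <= 1 & normc (z - center a d u) = normc b * radius u.
Proof.
move=> hT; split=> [[x /= x1 <-]|[u /andP[u0 u1]]].
  have := x1 => /lpnorm2_eq1 st.
  exists (normc (x 0 0) `^ p).
    by rewrite powR_ge0 -st lerDl powR_ge0.
  rewrite (semi_inner_upper _ _ _ _ _ hT x1) addrC addKr.
  rewrite !normcM normc_conjc normc_real ger0_norm ?powR_ge0//.
  rewrite mul_powRB2 ?normc_ge0// -mulrA; congr (_ * _).
  rewrite /radius (_ : 1 - _ `^ _ = normc (x 1 0) `^ p); last first.
    by rewrite -st addrC addKr.
  (* For [u] the p-th power of the first modulus, the exponent [1 - p^-1] becomes [p - 1], and
     [p^-1] gives back the second modulus itself. *)
  rewrite -!powRrM mulfV// powRr1 ?normc_ge0//.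
  by rewrite mulrC mulrBr mulr1 mulfV.
have v0 : 0 <= 1 - u by rewrite subr_ge0.
rewrite -[radius u](ger0_norm _) ?mulr_ge0 ?powR_ge0//.
rewrite -normc_real -normcM => /eq_normc_phase [e e1 ze].
(* The first coordinate is real and nonnegative, so the second one carries the whole phase [e] of
   [z - center a d u] relative to [b * C (radius u)]. *)
pose x : 'cV[R[i]]_2 := \col_(i < 2)
  if i == 0 then C (u `^ p^-1) else C ((1 - u) `^ p^-1) * e.
have x0E : x 0 0 = C (u `^ p^-1) by rewrite mxE.
have x1E : x 1 0 = C ((1 - u) `^ p^-1) * e by rewrite mxE.
have n0 : normc (x 0 0) = u `^ p^-1.
  by rewrite x0E normc_real ger0_norm ?powR_ge0.
have n0p : normc (x 0 0) `^ p = u by rewrite n0 -powRrM mulVf// powRr1.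
have x1 : lpnorm p x = 1.
  apply/lpnorm2_eq1; rewrite n0p x1E normcM e1 mulr1 normc_real.
  by rewrite ger0_norm ?powR_ge0// -powRrM mulVf// powRr1// subrKC.
exists x => //; rewrite (semi_inner_upper _ _ _ _ _ hT x1) n0p.
suff -> : conjc (x 0 0) * C (normc (x 0 0) `^ (p - 2)) =
    C (u `^ (1 - p^-1)).
  rewrite x1E -[RHS](subrKC (center a d u)) ze /radius rmorphM; congr (_ + _).
  by ring.
rewrite n0 x0E conjc_real -rmorphM mul_powRB2 ?powR_ge0// -powRrM.
by rewrite mulrBr mulVf// mulr1.
Qed.

(** [radius] is a weighted geometric mean of [u] and [1 - u], both affine in [u]. *)
Lemma radius_conv (l u v : R) :
  0 <= l <= 1 -> 0 <= u <= 1 -> 0 <= v <= 1 ->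
  l * radius u + (1 - l) * radius v <= radius (l * u + (1 - l) * v).
Proof.
move=> l01 /andP[u0 u1] /andP[v0 v1].
rewrite {3}/radius (_ : 1 - (_ + _) = l * (1 - u) + (1 - l) * (1 - v));
  last by ring.
by apply: geo_mean_conv; rewrite ?subr_ge0 ?subrK.
Qed.

(** As the parameter decreases from [u] to 0, the disc around [center a d v] shrinks to the point
    [d], so its boundary must meet [z] on the way. *)
Lemma circle_of_disc a b d z u :
  0 <= u <= 1 -> normc (z - center a d u) <= normc b * radius u ->
  exists2 v, 0 <= v <= 1 & normc (z - center a d v) = normc b * radius v.
Proof.
move=> /andP[u0 u1] zu.
(* Radius minus distance from [z] to the center: a zero in [[0, 1]] is a circle through [z]. The
   absolute values make [f] continuous on the whole line and change nothing on [[0, 1]]. *)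
pose f (v : R) := normc b * (`|v| `^ (1 - p^-1) * `|1 - v| `^ p^-1)
  - normc ((z - d) + C v * (d - a)).
have fE v : 0 <= v <= 1 -> f v = normc b * radius v - normc (z - center a d v).
  move=> /andP[v0 v1]; rewrite /f !ger0_norm ?subr_ge0// /radius /center.
  by congr (_ - normc _); ring.
have cf : continuous f.
  move=> v; have cst (k : R) : {for v, continuous (fun _ : R => k)}.
    exact: cvg_cst.
  have c1 : {for v, continuous (fun v : R => `|1 - v| `^ p^-1)}.
    apply: (@continuous_comp _ _ _ (fun v : R => 1 - v)
      (fun v => `|v| `^ p^-1)).
      by apply: (continuousB (cst 1)); exact: cvg_id.
    exact: continuous_norm_powR.
  have c0 := continuousM (continuous_norm_powR _ _ cpV_gt0 v) c1.
  exact: continuousB (continuousM (cst _) c0) (continuous_normc_affine _ _ _ v).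
have f0 : f 0 <= 0.
  by rewrite /f normr0 powR0 ?gt_eqF// mul0r mulr0 sub0r oppr_le0 normc_ge0.
have fu : 0 <= f u by rewrite fE ?u0// subr_ge0.
have [|v] := @IVT _ f 0 u 0 u0 (continuous_subspaceT cf).
  by rewrite ge_min f0 le_max fu orbT.
rewrite in_itv /= => /andP[v0 vu].
have v01 : 0 <= v <= 1 by rewrite v0 (le_trans vu).
by rewrite fE// => /eqP; rewrite subr_eq0 => /eqP fv; exists v.
Qed.

End upper_triangular.

(* Rcomplex R is R[i] with its structure of R-module: the weights of the
   convex combinations in convex_set are real numbers of [0, 1]. *)
Theorem corollary2p6p1 (R : realType) (p : R) (hp : 1 < p) (a b d : R[i])
    (T : {linear 'cV[R[i]]_2 -> 'cV[R[i]]_2})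
    (hT : forall x : 'cV[R[i]]_2,
        T x = (block_mx a%:M b%:M 0 d%:M : 'M[R[i]]_(1 + 1)) *m x) :
  @convex_set R (Rcomplex R) (numerical_range p T).
Proof.
move=> x y l; rewrite !inE.
move=> /(numerical_range_upper _ _ hp _ _ _ _ _ hT)[u u01 xu].
move=> /(numerical_range_upper _ _ hp _ _ _ _ _ hT)[v v01 yv].
apply/(numerical_range_upper _ _ hp _ _ _ _ _ hT).
have l01 : 0 <= l%:num <= 1 by rewrite ge0 le1.
have m0 : 0 <= 1 - l%:num by rewrite subr_ge0 le1.
(* It is enough to reach the disc whose parameter is the same convex combination of [u] and [v]. *)
apply: (circle_of_disc _ _ hp _ _ _ _ (l%:num * u + (1 - l%:num) * v)).
  have /andP[u0 u1] := u01; have /andP[v0 v1] := v01; have /andP[l0 l1] := l01.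
  by rewrite addr_ge0 ?mulr_ge0//=; nra.
have rad := radius_conv _ _ hp _ _ _ l01 u01 v01.
apply: (le_trans _ (ler_wpM2l (normc_ge0 _ b) rad)).
have -> : conv l x y =
    real_complex R l%:num * x + real_complex R (1 - l%:num) * y.
  by case: x y {xu yv} => [x1 x2] [y1 y2]; congr Complex;
    rewrite /= /onem; ring.
set c := center _ _ _ _.
(* The center is affine in its parameter, so the difference splits and the triangle inequality
   bounds it by the averaged radii. *)
have -> : real_complex R l%:num * x + real_complex R (1 - l%:num) * y - c =
    real_complex R l%:num * (x - center _ a d u) +
    real_complex R (1 - l%:num) * (y - center _ a d v).
  by rewrite /c /center; ring.
apply: (le_trans (le_normcD _ _)).
rewrite !normcM !normc_real !ger0_norm ?(andP l01).1// xu yv.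
by rewrite mulrDr !(mulrCA (normc b)).
Qed.
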